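(* Let $h\ge 3$ and let $M_h$ be the Möbius ladder with $h$ rungs. Then $pn(\mathcal{E}_{c}(M_{h}))=3$.
   Context: The Möbius ladder $M_h$ ($h\ge 3$) is the graph obtained from the cycle $v_1v_2\cdots v_{2h}v_1$ by adding the $h$ chords $v_iv_{i+h}$ for $1\le i\le h$; in particular $M_3=K_{3,3}$. A book embedding of a graph consists of a linear order of its vertices (along the spine) together with an assignment of each edge to one of finitely many pages, such that no two edges assigned to the same page cross, where edges $ab$ and $cd$ cross iff their endpoints alternate in the linear order. The pagenumber $pn(G)$ is the minimum number of pages over all book embeddings of $G$. For a graph $G$, the complete expansion graph $\mathcal{E}_{c}(G)$ is the graph with vertex set $\{(v,e) : v\in V(G),\ e\in E(G),\ v \text{ is incident with } e\}$ and edge set $E_1\cup E_2$, where $E_1=\{(v,e)(v,f) : v\in V(G),\ e\neq f \in E(G) \text{ both incident with } v\}$ and $E_2=\{(v,e)(w,e) : e=vw\in E(G)\}$ (each vertex $v$ is replaced by a complete graph $K_{d_G(v)}$, and each edge $vw$ of $G$ becomes one edge joining these complete graphs). *)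

(* Defs.v *)
From mathcomp Require Import all_boot.

Set Implicit Arguments.
Unset Strict Implicit.
Unset Printing Implicit Defensive.

Record sgraph := SGraph {
  vertex :> finType;
  adj : rel vertex;
  adj_sym : symmetric adj;
  adj_irr : irreflexive adj }.

Definition edges (G : sgraph) : {set {set G}} :=
  [set e | [exists x, exists y, adj x y && (e == [set x; y])]].

Definition edge (G : sgraph) := {e : {set G} | e \in edges G}.

Section BookEmbedding.

Variable G : sgraph.

(* A linear order of the vertices is given by the map sending each vertex to
   its position along the spine; injectivity is required in book_embedding. *)
Definition spine := {ffun G -> 'I_#|G|}.

Definition interleaved (pos : spine) (e f : {set G}) : bool :=
  [exists a, exists b, exists c, exists d,
    [&& e == [set a; b], f == [set c; d],
        pos a < pos c, pos c < pos b & pos b < pos d]].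

Definition cross (pos : spine) (e f : {set G}) : bool :=
  interleaved pos e f || interleaved pos f e.

Definition book_embedding k (pos : spine) (page : {ffun edge G -> 'I_k}) :=
  injectiveb pos &&
  [forall e, forall f, (page e == page f) ==> ~~ cross pos (val e) (val f)].

Definition embeds_in_pages k : bool :=
  [exists pos : spine, exists page : {ffun edge G -> 'I_k},
    book_embedding pos page].

Lemma interleaved_irr (pos : spine) (e : {set G}) :
  ~~ interleaved pos e e.
Proof.
apply/negP=> /existsP[a /existsP[b /existsP[c /existsP[d]]]].
case/and5P=> /eqP-> /eqP eq_ab ac cb bd.
have: c \in [set a; b] by rewrite eq_ab set21.
by rewrite !inE => /orP[]/eqP c_eq; move: ac cb; rewrite c_eq ltnn.
Qed.

(* One page per edge. *)
Lemma embeds_in_some_pages : exists k, embeds_in_pages k.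
Proof.
exists #|{: edge G}|.
apply/existsP; exists [ffun x => enum_rank x].
apply/existsP; exists [ffun e => enum_rank e].
have pos_inj : injective [ffun x : G => enum_rank x].
  by move=> x y; rewrite !ffunE => /enum_rank_inj.
apply/andP; split; first exact/injectiveP.
apply/forallP=> e; apply/forallP=> f; apply/implyP.
rewrite !ffunE => /eqP/enum_rank_inj <-.
by rewrite /cross orbb; exact: interleaved_irr.
Qed.

Definition pagenumber : nat := ex_minn embeds_in_some_pages.

End BookEmbedding.

Section CompleteExpansion.

Variable G : sgraph.

Definition flag := {p : G * edge G | p.1 \in val p.2}.

(* Since both flags are incident pairs, v != w and e == f force e = vw. *)
Definition cexp_adj (p q : flag) : bool :=
  let: (v, e) := val p in let: (w, f) := val q in
  (v == w) && (e != f) || (v != w) && (e == f).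

Lemma cexp_adj_sym : symmetric cexp_adj.
Proof.
by move=> [[v e] ?] [[w f] ?]; rewrite /cexp_adj /= (eq_sym w) (eq_sym f).
Qed.

Lemma cexp_adj_irr : irreflexive cexp_adj.
Proof. by move=> [[v e] ?]; rewrite /cexp_adj /= !eqxx. Qed.

Definition complete_expansion := SGraph cexp_adj_sym cexp_adj_irr.

End CompleteExpansion.

Section MobiusLadder.

Variable h : nat.

(* The vertex v_(i+1) is represented by i : 'I_(2 * h). *)
Definition mobius_arc (i j : 'I_(2 * h)) : bool :=
  (j == i.+1 %% (2 * h) :> nat) || (i < h) && (j == i + h :> nat).

Definition mobius_adj (i j : 'I_(2 * h)) : bool :=
  mobius_arc i j || mobius_arc j i.

Lemma mobius_adj_sym : symmetric mobius_adj.
Proof. by move=> i j; rewrite /mobius_adj orbC. Qed.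

Lemma mobius_adj_irr : irreflexive mobius_adj.
Proof.
move=> i; rewrite /mobius_adj orbb /mobius_arc.
have h_gt0 : 0 < h by case: h i => [[]|//].
have two_h : 1 < 2 * h by rewrite mul2n -addnn -addn1 leq_add.
have -> : (i == i + h :> nat) = false.
  by rewrite -{1}[val i]addn0 eqn_add2l ltn_eqF.
rewrite andbF orbF; apply/negbTE.
have [lt_i|ge_i] := ltnP i.+1 (2 * h).
  by rewrite modn_small // neq_ltn ltnSn.
have eq_i : i.+1 = 2 * h by apply/eqP; rewrite eqn_leq ge_i ltn_ord.
by rewrite eq_i modnn -lt0n -ltnS eq_i.
Qed.

Definition mobius_ladder := SGraph mobius_adj_sym mobius_adj_irr.

End MobiusLadder.

(* Main.v *)
(* Lower bound: expanding the vertices of a cubic graph into triangles keeps a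
   subdivision of it, so the complete expansion of M_h contains a subdivision of
   K_{3,3}. Its flags, taken vertex by vertex along the rim, form a Hamiltonian
   cycle 0, 1, ..., 6h - 1, in which the rungs are the chords joining 3i + 1 to
   3i + 1 + 3h; three of them and the cycle make up the subdivision. A 2-page
   embedding of a subdivided K_{3,3} is excluded by a parity count over the pairs of
   disjoint paths rather than by planarity.

   Upper bound: lay out the flags of v_1, ..., v_h forwards and then those of
   v_(h+1), ..., v_(2h) backwards. The rungs become nested, the triangle
   edges that skip a rung flag share a second page with one of the two twisted rim
   edges, and the other twisted edge takes the third page. *)

Require Import Defs.
From mathcomp Require Import all_boot zify.
From Stdlib Require Import Ring.

Set Implicit Arguments.
Unset Strict Implicit.
Unset Printing Implicit Defensive.

(** * Two-element sets and the boolean ring *)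

Lemma eq_set2 (T : finType) (a b c d : T) :
  ([set a; b] == [set c; d]) = (a == c) && (b == d) || (a == d) && (b == c).
Proof.
apply/eqP/idP => [E|/orP[]/andP[/eqP-> /eqP->] //]; last by rewrite setUC.
have: a \in [set c; d] by rewrite -E set21.
have: b \in [set c; d] by rewrite -E set22.
have: c \in [set a; b] by rewrite E set21.
have: d \in [set a; b] by rewrite E set22.
rewrite !inE (eq_sym d) (eq_sym c) (eq_sym d b) (eq_sym c b).
by do 4!case: (_ == _).
Qed.

Lemma addb_xorb : addb =2 xorb.
Proof. by do 2!case. Qed.

Lemma negb_xorb b : ~~ b = xorb true b.
Proof. by case: b. Qed.

(** [ring] knows the booleans with [xorb] as addition, so parity identities are moved there
    first. *)
Ltac addb_ring := rewrite /= !addb_xorb; rewrite ?negb_xorb; ring.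

(** * Book embeddings as vertex keys and edge colours *)

Section BookEmbeddings.

Variable G : sgraph.
Implicit Types a b c d x y : G.

Lemma mem_edges x y : adj x y -> [set x; y] \in edges G.
Proof.
by move=> xy; rewrite inE; apply/existsP; exists x; apply/existsP; exists y; rewrite xy /=.
Qed.

Lemma edgesP (e : edge G) :
  exists p : G * G, adj p.1 p.2 && (val e == [set p.1; p.2]).
Proof.
have := valP e; rewrite inE => /existsP[x /existsP[y E]].
by exists (x, y).
Qed.

(** Counting the vertices of smaller key turns any injective key into spine positions; the ends of
    an edge are chosen in an arbitrary order, harmless as [col] is symmetric. *)
Lemma embeds_in_pages_of_key k (key : G -> nat) (col : G -> G -> 'I_k) :
    injective key -> (forall x y, col x y = col y x) ->
    (forall a b c d, adj a b -> adj c d ->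
       key a < key c -> key c < key b -> key b < key d -> col a b != col c d) ->
  embeds_in_pages G k.
Proof.
move=> key_inj colC col_ok.
pose rank x := #|[set y | key y < key x]|.
have rank_lt x : rank x < #|G|.
  rewrite -cardsT proper_card // properE subsetT; apply/subsetPn.
  by exists x; rewrite ?inE ?ltnn.
have rank_mono x y : rank x < rank y -> key x < key y.
  apply: contraTT; rewrite -!leqNgt => le_yx.
  by apply: subset_leq_card; apply/subsetP => z; rewrite !inE => /leq_trans; apply.
have key_mono x y : key x < key y -> rank x < rank y.
  move=> lt_xy; apply/proper_card/properP; split.
    by apply/subsetP => z; rewrite !inE => /ltn_trans; apply.
  by exists x; rewrite inE ?ltnn.
pose pos : spine G := [ffun x => Ordinal (rank_lt x)].
pose ends e := xchoose (edgesP e).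
pose page : {ffun edge G -> 'I_k} := [ffun e => col (ends e).1 (ends e).2].
have pageE e a b : val e = [set a; b] -> adj a b /\ page e = col a b.
  move=> E; have := xchooseP (edgesP e); rewrite -/(ends e) ffunE E eq_set2.
  case/andP=> + /orP[]/andP[/eqP-> /eqP->] => // xy.
  by rewrite adj_sym colC.
apply/existsP; exists pos; apply/existsP; exists page; apply/andP; split.
  apply/injectiveP => x y; rewrite !ffunE => /(congr1 val) /= E.
  apply: key_inj; case: (ltngtP (key x) (key y)) => // /key_mono;
    by rewrite E ltnn.
have ok e f : interleaved pos (val e) (val f) -> page e != page f.
  case/existsP=> a /existsP[b /existsP[c /existsP[d]]].
  case/and5P=> /eqP/pageE[ab ->] /eqP/pageE[cd ->]; rewrite !ffunE /=.
  by move=> /rank_mono ac /rank_mono cb /rank_mono bd; apply: col_ok.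
apply/forallP=> e; apply/forallP=> f; apply/implyP => E.
by rewrite /cross negb_or; apply/andP; split; apply/negP => /ok; rewrite ?E // eq_sym E.
Qed.

Lemma key_of_embeds_in_pages k : embeds_in_pages G k ->
  exists (pos : G -> nat) (col : G -> G -> nat),
    [/\ injective pos, forall x y, col x y = col y x,
        forall x y, adj x y -> col x y < k
      & forall a b c d, adj a b -> adj c d ->
          pos a < pos c -> pos c < pos b -> pos b < pos d ->
          col a b != col c d].
Proof.
case/existsP=> pos /existsP[page /andP[/injectiveP pos_inj /forallP ok]].
(* Pairs that are not edges get the default colour 0. *)
pose col x y : nat := oapp (fun e => val (page e)) 0 (insub [set x; y]).
have colE x y : adj x y -> exists2 e : edge G, val e = [set x; y] & col x y = page e.
  by move/mem_edges=> xy; exists (exist (fun e => e \in edges G) _ xy) => //; rewrite /col insubT.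
exists (fun x => pos x : nat), col; split.
- by move=> x y /val_inj/pos_inj.
- by move=> x y; rewrite /col setUC.
- by move=> x y /colE[e _ ->].
move=> a b c d /colE[e eE ->] /colE[f fE ->] ac cb bd.
apply/negP => /eqP/val_inj/eqP E.
have /forallP/(_ f)/implyP/(_ E) := ok e; rewrite negb_or => /andP[/negP nI _]; apply: nI.
apply/existsP; exists a; apply/existsP; exists b.
apply/existsP; exists c; apply/existsP; exists d.
by rewrite eE fE !eqxx ac cb bd.
Qed.

(** * Crossing parities on two pages *)

Section TwoPages.

Variables (pos : G -> nat) (col : G -> G -> bool).
Hypothesis pos_inj : injective pos.
Hypothesis colC : forall x y, col x y = col y x.
Hypothesis col_ok : forall a b c d, adj a b -> adj c d ->
  pos a < pos c -> pos c < pos b -> pos b < pos d -> col a b != col c d.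

Let s x y := pos x < pos y.

Let sN x y : x != y -> s y x = ~~ s x y.
Proof.
move=> /negP neq; rewrite /s; case: ltngtP => // /pos_inj E.
by case: neq; rewrite E.
Qed.

(* Parity of the number of edges of the path [x :: p] on page [true] that pass
   over [y]. *)
Fixpoint over x (p : seq G) y : bool :=
  if p is z :: p' then (col x z && (s x y (+) s z y)) (+) over z p' y else false.

(** For distinct vertices, tells whether exactly one of [c], [d] lies between [a] and [b]; as a sum
    it telescopes along paths. *)
Let interlace a b c d := (s a c (+) s b c) (+) (s a d (+) s b d).

Lemma interlace_edges a b c d :
    adj a b -> adj c d -> a != c -> a != d -> b != c -> b != d ->
  interlace a b c d && (col a b == col c d) = false.
Proof.
move=> ab cd ac ad bc bd; apply/negP => /andP[I /eqP E].
wlog lt_ab : a b ab ac ad bc bd I E / pos a < pos b.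
  move=> H; case: (ltngtP (pos a) (pos b)) => [|lt|/pos_inj eq_ab]; first exact: H.
    apply: (H b a) => //; first by rewrite adj_sym.
      by move: I; rewrite /interlace; do 4!case: (s _ _).
    by rewrite colC.
  by move: ab; rewrite eq_ab adj_irr.
wlog lt_cd : c d cd ac ad bc bd I E / pos c < pos d.
  move=> H; case: (ltngtP (pos c) (pos d)) => [|lt|/pos_inj eq_cd]; first exact: H.
    apply: (H d c) => //; first by rewrite adj_sym.
      by move: I; rewrite /interlace; do 4!case: (s _ _).
    by rewrite E colC.
  by move: cd; rewrite eq_cd adj_irr.
have := @col_ok a b c d ab cd; have := @col_ok c d a b cd ab.
rewrite E eqxx; move: I (sN ac) (sN ad) (sN bc) (sN bd) lt_ab lt_cd.
rewrite /interlace /s; lia.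
Qed.

(** The [over] terms add up to [interlace a b c d] times [col a b (+) col c d], and interlacing
    edges have different colours. *)
Lemma addb_edges a b c d :
    adj a b -> adj c d -> a != c -> a != d -> b != c -> b != d ->
  interlace a b c d (+) (over a [:: b] c (+) over a [:: b] d)
    (+) (over c [:: d] a (+) over c [:: d] b) = false.
Proof.
move=> ab cd ac ad bc bd; have := interlace_edges ab cd ac ad bc bd.
rewrite /interlace /= (sN ac) (sN ad) (sN bc) (sN bd).
by do 4!case: (s _ _); do 2!case: (col _ _).
Qed.

Lemma addb_edge_path a b y q :
    adj a b -> path (@adj G) y q -> a \notin y :: q -> b \notin y :: q ->
  interlace a b y (last y q)
    (+) (over a [:: b] y (+) over a [:: b] (last y q))
    (+) (over y q a (+) over y q b) = false.
Proof.
move=> ab; elim: q y => [|w q IHq] y; first by rewrite /interlace /= !addbb.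
rewrite [path _ _ _]/= [last _ _]/= !(in_cons y) (negb_or (a == y)) (negb_or (b == y)).
case/andP=> yw wq /andP[ay aq] /andP[bY bq].
have := addb_edges ab yw ay _ bY _; have := IHq w wq aq bq.
move: aq bq; rewrite !inE !negb_or => /andP[-> _] /andP[-> _] E1 /(_ isT isT) E2.
(* With [false] replaced by the sum of both equations, the terms at [w] cancel. *)
rewrite -[RHS](f_equal2 addb E1 E2 : _ = false) /interlace.
addb_ring.
Qed.

(* Summed over all pairs of edges, the interlacing parities telescope to the
   endpoints of the two paths. *)
Lemma addb_paths x p y q :
    path (@adj G) x p -> path (@adj G) y q -> ~~ has (mem (x :: p)) (y :: q) ->
  interlace x (last x p) y (last y q)
    (+) (over x p y (+) over x p (last y q))
    (+) (over y q x (+) over y q (last x p)) = false.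
Proof.
move=> + yq; elim: p x => [|z p IHp] x; first by rewrite /interlace /= !addbb.
rewrite [path _ _ _]/= [last _ _]/= => /andP[xz zp] dis.
have zq : z \notin y :: q.
  by apply: contra dis => zq; apply/hasP; exists z; rewrite //= !inE eqxx orbT.
have xq : x \notin y :: q.
  by apply: contra dis => xq; apply/hasP; exists x; rewrite //= !inE eqxx.
have dis' : ~~ has (mem (z :: p)) (y :: q).
  apply: contra dis => /hasP[u uq up]; apply/hasP; exists u => //.
  by move: up; rewrite /= !inE => ->; rewrite orbT.
have E1 := IHp z zp dis'; have E2 := addb_edge_path xz yq xq zq.
rewrite -[RHS](f_equal2 addb E1 E2 : _ = false) /interlace.
addb_ring.
Qed.

(* The number of pairs of disjoint edges of K_{3,3} that interlace is odd for
   every linear order: swapping two consecutive vertices changes it by an even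
   number. The page-dependent terms cancel, since the edges disjoint from a given
   one form a 4-cycle. *)
Lemma no_K33 (a b : nat -> G) (p : nat -> nat -> seq G) :
    (forall i j, i < 3 -> j < 3 -> path (@adj G) (a i) (p i j)) ->
    (forall i j, i < 3 -> j < 3 -> last (a i) (p i j) = b j) ->
    (forall i j i' j', i < i' < 3 -> j < 3 -> j' < 3 -> j != j' ->
       ~~ has (mem (a i :: p i j)) (a i' :: p i' j')) ->
  False.
Proof.
move=> pP lastP disP.
have E i j i' j' : i < i' < 3 -> j < 3 -> j' < 3 -> j != j' ->
    interlace (a i) (b j) (a i') (b j')
    (+) (over (a i) (p i j) (a i') (+) over (a i) (p i j) (b j'))
    (+) (over (a i') (p i' j') (a i) (+) over (a i') (p i' j') (b j)) = false.
  case/andP=> lt_ii' lt_i' lt_j lt_j' neq_j.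
  have lt_i : i < 3 by apply: ltn_trans lt_i'.
  by rewrite -(lastP i j) // -(lastP i' j') // addb_paths ?pP ?disP ?lt_ii'.
have bneq j j' : j < 3 -> j' < 3 -> j != j' -> b j != b j'.
  move=> lt_j lt_j' /(disP 0 j 1 j' isT lt_j lt_j'); apply: contra => /eqP eq_b.
  apply/hasP; exists (b j'); rewrite /=; first by rewrite -(lastP 1 j') // mem_last.
  by rewrite -eq_b -(lastP 0 j) // mem_last.
pose sum i i' := \big[addb/false]_(jj <- [:: (0, 1); (0, 2); (1, 0); (1, 2); (2, 0); (2, 1)])
    (interlace (a i) (b jj.1) (a i') (b jj.2)
    (+) (over (a i) (p i jj.1) (a i') (+) over (a i) (p i jj.1) (b jj.2))
    (+) (over (a i') (p i' jj.2) (a i) (+) over (a i') (p i' jj.2) (b jj.1))).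
have sum0 i i' : i < i' < 3 -> sum i i' = false.
  by move=> lt_ii'; rewrite /sum !big_cons big_nil /= !E.
suff: sum 0 1 (+) sum 0 2 (+) sum 1 2 = true by rewrite !sum0.
rewrite /sum !big_cons !big_nil /interlace /=.
(* All terms cancel in pairs except the comparisons between the [b j]: each of the three pairs of
   them contributes [s x y (+) s y x = true] three times, an odd total of nine. *)
rewrite (sN (bneq 0 1 isT isT isT)) (sN (bneq 0 2 isT isT isT)).
rewrite (sN (bneq 1 2 isT isT isT)).
addb_ring.
Qed.

End TwoPages.
End BookEmbeddings.

(** * Flags as directed edges *)

Section CexpFlags.

Variable G : sgraph.
Implicit Types (v w : G) (x y : flag G).

Lemma flag_ends x : 
  exists w, adj (val x).1 w && (val (val x).2 == [set (val x).1; w]).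
Proof.
case: x => [[v e] /=]; have [[a b] /= /andP[ab /eqP E]] := edgesP e.
rewrite {1}E !inE => /orP[]/eqP->; first by exists b; rewrite ab E /=.
by exists a; rewrite adj_sym ab E setUC /=.
Qed.

Lemma flag_of v w : adj v w ->
  exists x, (val x).1 = v /\ val (val x).2 = [set v; w].
Proof.
move=> vw.
pose e : edge G := exist (fun e => e \in edges G) _ (mem_edges vw).
have ve : v \in val e by rewrite set21.
by exists (exist (fun p : G * edge G => p.1 \in val p.2) (v, e) ve).
Qed.

Lemma cexp_adjE x y v w v' w' :
    adj v w -> adj v' w' ->
    (val x).1 = v -> val (val x).2 = [set v; w] ->
    (val y).1 = v' -> val (val y).2 = [set v'; w'] ->
  cexp_adj x y = (v == v') && (w != w') || (v == w') && (w == v').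
Proof.
rewrite /cexp_adj; case: x y => [[a e] ae] [[b f] bf] /= vw vw' -> eE -> fE.
have -> : (e == f) = (sval e == sval f) by [].
rewrite eE fE eq_set2.
have nvw : v != w by apply: contraTneq vw => ->; rewrite adj_irr.
have nvw' : v' != w' by apply: contraTneq vw' => ->; rewrite adj_irr.
have: ~~ ((v == v') && (v == w')) by apply: contra nvw' => /andP[/eqP<- /eqP<-].
have: ~~ ((v == v') && (w == v')) by apply: contra nvw => /andP[/eqP-> /eqP->].
by do 4!case: (_ == _).
Qed.

End CexpFlags.

(** * Numbering the flags of the Möbius ladder *)

Section MobiusPages.

Variable h : nat.
Hypothesis h_ge3 : 3 <= h.

Let M := mobius_ladder h.
Let E := complete_expansion M.

(** The wrap-around is a separate case instead of a remainder, which suits [lia]. *)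
Definition cyc_next (v w : nat) := (w == v.+1) || (v == (2 * h).-1) && (w == 0).

Lemma mobius_adjE (v w : M) :
  adj v w = [|| cyc_next v w, cyc_next w v, w == v + h :> nat | v == w + h :> nat].
Proof.
have arcE (i j : M) : mobius_arc i j = cyc_next i j || (j == i + h :> nat).
  rewrite /mobius_arc /cyc_next; have := ltn_ord i; have := ltn_ord j.
  have [lt_i|ge_i] := ltnP i.+1 (2 * h); first by rewrite modn_small //; lia.
  move=> lt_j lt_i; have -> : i.+1 = 2 * h by lia.
  by rewrite modnn; lia.
by rewrite /= /mobius_adj !arcE; lia.
Qed.

(* For adjacent [v] and [w], tells whether [w] is the rim predecessor (0), the other
   end of the rung (1) or the rim successor (2) of [v]. *)
Definition place (v w : nat) := if cyc_next w v then 0 else if cyc_next v w then 2 else 1.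

Lemma placeP (v w : nat) :
    v < 2 * h -> w < 2 * h ->
    [|| cyc_next v w, cyc_next w v, w == v + h | v == w + h] ->
  [\/ place v w = 0 /\ (v = w.+1 \/ v = 0 /\ w = (2 * h).-1),
      place v w = 1 /\ (w = v + h \/ v = w + h)
    | place v w = 2 /\ (w = v.+1 \/ w = 0 /\ v = (2 * h).-1)].
Proof.
rewrite /place => lt_v lt_w; case: ifP; rewrite /cyc_next; first by constructor 1; lia.
case: ifP; first by constructor 3; lia.
by constructor 2; lia.
Qed.

Lemma place_surj m : m < 6 * h ->
  exists (v w : M), adj v w /\ v * 3 + place v w = m.
Proof.
move=> lt_m.
have [v lt_v [t lt_t ->]] : exists2 v, v < 2 * h & exists2 t, t < 3 & m = v * 3 + t.
  by exists (m %/ 3); [lia | exists (m %% 3); lia].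
suff [w lt_w [vw <-]] : exists2 w, w < 2 * h &
    [|| cyc_next v w, cyc_next w v, w == v + h | v == w + h] /\ place v w = t.
  by exists (Ordinal lt_v), (Ordinal lt_w); rewrite mobius_adjE.
rewrite /place /cyc_next; case: t lt_t => [|[|[|//]]] _.
- by case: v lt_v => [|v] lt_v; [exists (2 * h).-1 | exists v]; try split; repeat case: ifP; lia.
- by case: (ltnP v h) => vh; [exists (v + h) | exists (v - h)]; try split; repeat case: ifP; lia.
- by have [->|] := eqVneq v (2 * h).-1; [exists 0 | exists v.+1]; try split; repeat case: ifP; lia.
Qed.

(* The adjacencies of the complete expansion when the flag [(v, vw)] is numbered
   [v * 3 + place v w], each in one of its two directions. *)
Definition index_arc (m n : nat) :=
  [|| n == m.+1, (m == 0) && (n == (6 * h).-1), (m %% 3 == 0) && (n == m + 2)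
    | (m %% 3 == 1) && (n == m + 3 * h)].

(** A triangle joins the three places of one vertex, a rim edge joins place 2 of a vertex to place 0
    of its successor, and a rung joins two places 1 at distance [3 * h]. *)
Lemma arc_place (v w v' w' : nat) :
    v < 2 * h -> w < 2 * h -> v' < 2 * h -> w' < 2 * h ->
    [|| cyc_next v w, cyc_next w v, w == v + h | v == w + h] ->
    [|| cyc_next v' w', cyc_next w' v', w' == v' + h | v' == w' + h] ->
  (v == v') && (w != w') || (v == w') && (w == v') =
  index_arc (v * 3 + place v w) (v' * 3 + place v' w')
  || index_arc (v' * 3 + place v' w') (v * 3 + place v w).
Proof.
move=> lt_v lt_w lt_v' lt_w' /(placeP lt_v lt_w) vw /(placeP lt_v' lt_w') vw'.
rewrite /index_arc.
case: vw => -[-> E1]; case: vw' => -[-> E2]; rewrite !modnMDl /=;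
 case: E1 => E1; case: E2 => E2; lia.
Qed.

(** Reduces both bounds to arithmetic below [6 * h]. The number of a flag fixes [v] and the place,
    hence [w]. *)
Lemma index_exists : exists idx : E -> nat,
  [/\ injective idx, forall x, idx x < 6 * h,
      forall m, m < 6 * h -> exists x, idx x = m
    & forall x y, adj x y = index_arc (idx x) (idx y) || index_arc (idx y) (idx x)].
Proof.
pose other (x : E) : M := xchoose (flag_ends x).
pose idx (x : E) := (val x).1 * 3 + place (val x).1 (other x).
have otherP x : adj (val x).1 (other x) by case/andP: (xchooseP (flag_ends x)).
have edgeE x : val (val x).2 = [set (val x).1; other x].
  by case/andP: (xchooseP (flag_ends x)) => _ /eqP.
exists idx; split.
- move=> x y; rewrite /idx => Exy.
  have [Ev Ew] : (val x).1 = (val y).1 /\ other x = other y.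
    move: (otherP x) (otherP y) Exy; rewrite !mobius_adjE.
    move: (val x).1 (val y).1 (other x) (other y) => v v' w w'.
    have [lt_v lt_v'] := (ltn_ord v, ltn_ord v').
    have [lt_w lt_w'] := (ltn_ord w, ltn_ord w').
    move=> /(placeP lt_v lt_w) vw /(placeP lt_v' lt_w') vw' Evw.
    split; apply: val_inj => /=; move: Evw;
    by case: vw => -[-> E1]; case: vw' => -[-> E2]; lia.
  apply: val_inj; rewrite [val x]surjective_pairing [val y]surjective_pairing Ev.
  by congr pair; apply: val_inj; rewrite /= edgeE [in RHS]edgeE Ev Ew.
- move=> x; rewrite /idx; have := ltn_ord (val x).1.
  by rewrite /place; case: ifP => _; last case: ifP => _; lia.
- move=> m lt_m.
  have [v [w [vw mE]]] := place_surj lt_m.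
  have [x [xv xe]] := flag_of vw; exists x; rewrite /idx -mE xv.
  have: other x == w.
    have /eqP := edgeE x; rewrite xe xv eq_set2 eqxx => /orP[/eqP->//|].
    case/andP=> _ /eqP wv; move: vw; rewrite wv.
    by rewrite adj_irr.
  by move/eqP->.
move=> x y; rewrite [LHS](cexp_adjE (otherP x) (otherP y)) //.
move: (otherP x) (otherP y); rewrite !mobius_adjE.
by apply: arc_place; apply: ltn_ord.
Qed.

(** * The three-page layout *)

(** The second half of the cycle is reflected onto itself, so the two keys of a rung sum to
    [(6 * h).-1]. *)
Definition key m := if m < 3 * h then m else 9 * h - m.+1.

Lemma key_inj m n : m < 6 * h -> n < 6 * h -> key m = key n -> m = n.
Proof. by move=> ? ?; rewrite /key; case: ltnP => ?; case: ltnP => ?; lia.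
Qed.

(* The last page is spent on the single edge closing the Hamiltonian cycle. *)
Definition arc_page m n :=
  if (m == 0) && (n == (6 * h).-1) then 2 else
  if (n == m + 2) || (m == (3 * h).-1) && (n == 3 * h) then 1 else 0.

(** On the reverse of an arc [arc_page] is 0, so the maximum is the page of the arc. *)
Definition page_of m n := maxn (arc_page m n) (arc_page n m).
(** Here [a < b] are keys. Page 0 has unit steps and nested chords. Page 1 has triangle chords over
    disjoint intervals and one twisted rim edge, both of whose ends are also ends of such
    intervals. *)
Definition page_spec p a b :=
  [\/ p = 0 /\ (b = a.+1 \/ a + b = (6 * h).-1),
      p = 1 /\ (a %% 3 = 0 /\ b = a + 2 \/
                          a = (3 * h).-1 /\ b = (6 * h).-1)
    | p = 2 /\ (a = 0 /\ b = 3 * h)].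

Lemma page_arcP a b :
    a < 6 * h -> b < 6 * h -> index_arc a b ->
    page_spec (page_of a b) (minn (key a) (key b)) (maxn (key a) (key b)).
Proof.
move=> lt_a lt_b /or4P[/eqP Eb|/andP[/eqP Ea /eqP Eb]|/andP[/eqP a3 /eqP Eb]|/andP[/eqP a3 /eqP Eb]].
- have [Ea|nEa] := eqVneq a (3 * h).-1.
    have -> : page_of a b = 1 by rewrite /page_of /arc_page; do 4?case: ifP; lia.
    by constructor 2; rewrite /key; case: ltnP => ?; case: ltnP => ?; lia.
  have -> : page_of a b = 0 by rewrite /page_of /arc_page; do 4?case: ifP; lia.
  by constructor 1; rewrite /key; case: ltnP => ?; case: ltnP => ?; lia.
- have -> : page_of a b = 2 by rewrite /page_of /arc_page; do 4?case: ifP; lia.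
  by constructor 3; rewrite /key; case: ltnP => ?; case: ltnP => ?; lia.
- have -> : page_of a b = 1 by rewrite /page_of /arc_page; do 4?case: ifP; lia.
  by constructor 2; rewrite /key; case: ltnP => ?; case: ltnP => ?; lia.
- have -> : page_of a b = 0 by rewrite /page_of /arc_page; do 4?case: ifP; lia.
  by constructor 1; rewrite /key; case: ltnP => ?; case: ltnP => ?; lia.
Qed.

Lemma page_ofP a b :
    a < 6 * h -> b < 6 * h -> index_arc a b || index_arc b a -> key a < key b ->
  page_spec (page_of a b) (key a) (key b).
Proof.
move=> lt_a lt_b /orP[]ab lt_ab.
  by have := page_arcP lt_a lt_b ab; rewrite (minn_idPl (ltnW lt_ab)) (maxn_idPr (ltnW lt_ab)).
have := page_arcP lt_b lt_a ab; rewrite (minn_idPr (ltnW lt_ab)) (maxn_idPl (ltnW lt_ab)).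
by rewrite /page_of maxnC.
Qed.

Lemma key_lt m : m < 6 * h -> key m < 6 * h.
Proof. by rewrite /key; case: (ltnP m (3 * h)); lia. Qed.

Lemma page_of_ok a b c d :
    a < 6 * h -> b < 6 * h -> c < 6 * h -> d < 6 * h ->
    index_arc a b || index_arc b a -> index_arc c d || index_arc d c ->
    key a < key c -> key c < key b -> key b < key d ->
  page_of a b != page_of c d.
Proof.
move=> lt_a lt_b lt_c lt_d ab cd ac cb bd; have := key_lt lt_d.
have := page_ofP lt_a lt_b ab (ltn_trans ac cb).
have := page_ofP lt_c lt_d cd (ltn_trans cb bd).
move: (page_of a b) (page_of c d) => p q.
move: (key a) (key b) (key c) (key d) ac cb bd {lt_a lt_b lt_c lt_d ab cd}.
rewrite /page_spec => {}a {}b {}c {}d ac cb bd.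
by move=> [] [-> cdE] [] [-> abE] // lt_d; lia.
Qed.

Lemma embeds_in_3_pages : embeds_in_pages E 3.
Proof.
have [idx [idx_inj idx_lt _ idxE]] := index_exists.
have keyI : injective (fun x => key (idx x)).
  by move=> x y /key_inj Exy; apply/idx_inj/Exy.
have page_lt m n : page_of m n < 3.
  by rewrite /page_of gtn_max /arc_page; repeat case: ifP.
apply: (@embeds_in_pages_of_key _ 3 _ (fun x y => Ordinal (page_lt (idx x) (idx y))) keyI).
  by move=> x y; apply: val_inj; rewrite /= /page_of maxnC.
move=> a b c d; rewrite !idxE => ab cd ac cb bd.
by rewrite -(inj_eq val_inj) /=; apply: page_of_ok.
Qed.

(** * The subdivided K_{3,3} and the lower bound *)

Lemma path_iota (e : rel nat) m n : (forall i, e i i.+1) -> path e m (iota m.+1 n).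
Proof. by move=> e_succ; elim: n m => //= n IHn m; rewrite e_succ IHn. Qed.

Lemma last_iota m n : last m (iota m.+1 n) = m + n.
Proof. by elim: n m => [|n IHn] m /=; rewrite ?addn0 // IHn addnS. Qed.

Lemma rev_iotaS m n : rev (iota m n.+1) = (m + n) :: rev (iota m n).
Proof. by rewrite -addn1 iotaD rev_cat. Qed.

Lemma path_rev_iota (e : rel nat) m n : (forall i, e i.+1 i) ->
  path e (m + n) (rev (iota m n)).
Proof.
move=> e_pred; elim: n => [|n IHn]; first by rewrite addn0.
by rewrite rev_iotaS /= addnS e_pred.
Qed.

Lemma last_rev_iota m n : last (m + n) (rev (iota m n)) = m.
Proof. by elim: n => [|n IHn]; rewrite ?addn0 // rev_iotaS. Qed.

Definition branchA i := nth 0 [:: 1; 7; 3 * h + 4] i.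
Definition branchB i := nth 0 [:: 4; 3 * h + 1; 3 * h + 7] i.
(* The branch vertices are the ends of three rungs, which alternate between the two
   sides of K_{3,3} along the cycle. *)
Definition subdiv i j := nth [::] (nth [::]
  [:: [:: iota 2 3; [:: 3 * h + 1]; [:: 0, (6 * h).-1 & rev (iota (3 * h + 7) (3 * h - 8))]];
      [:: rev (iota 4 3); iota 8 (3 * h - 6); [:: 3 * h + 7]];
      [:: [:: 4]; rev (iota (3 * h + 1) 3); iota (3 * h + 5) 3]] i) j.

Lemma subdiv_lt i j m : i < 3 -> j < 3 -> m \in branchA i :: subdiv i j -> m < 6 * h.
Proof.
case: i => [|[|[|//]]]; case: j => [|[|[|//]]] _ _;
  rewrite /branchA /subdiv /nth !in_cons ?mem_rev ?mem_iota ?in_nil; lia.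
Qed.

Lemma subdiv_path i j : i < 3 -> j < 3 ->
  path (fun m n => index_arc m n || index_arc n m) (branchA i) (subdiv i j).
Proof.
set e := fun m n => _.
have up m : e m m.+1 by rewrite /e /index_arc eqxx.
have down m : e m.+1 m by rewrite /e /index_arc eqxx orbT.
have PU m n := path_iota m n up; have PD m n := path_rev_iota m n down.
case: i => [|[|[|//]]]; case: j => [|[|[|//]]] _ _; rewrite /branchA /subdiv /nth.
- exact: PU.
- by rewrite /= /e /index_arc; lia.
(* This path uses the closing edge of the cycle: from 1 to 0, across to [(6 * h).-1], then down to
   [3 * h + 7]. *)
- apply/and3P; split; [exact: (down 0) | by rewrite /e /index_arc !eqxx orbT|].
  by have := PD (3 * h + 7) (3 * h - 8); have -> : 3 * h + 7 + (3 * h - 8) = (6 * h).-1 by lia.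
- exact: (PD 4 3).
- exact: PU.
- by rewrite /= /e /index_arc; lia.
- by rewrite /= /e /index_arc; lia.
- by have := PD (3 * h + 1) 3; rewrite -addnA.
- by have := PU (3 * h + 4) 3; rewrite -addnS.
Qed.

Lemma subdiv_last i j : i < 3 -> j < 3 -> last (branchA i) (subdiv i j) = branchB j.
Proof.
case: i => [|[|[|//]]]; case: j => [|[|[|//]]] // _ _; rewrite /branchA /branchB /subdiv /nth.
- rewrite /=.
  by have := last_rev_iota (3 * h + 7) (3 * h - 8); have -> : 3 * h + 7 + (3 * h - 8) = (6 * h).-1 by lia.
- by rewrite last_iota; lia.
- by have := last_iota (3 * h + 4) 3; rewrite -addnS -addnA.
Qed.

Lemma subdiv_disjoint i j i' j' m :
    i < i' < 3 -> j < 3 -> j' < 3 -> j != j' ->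
  m \in branchA i :: subdiv i j -> m \in branchA i' :: subdiv i' j' -> False.
Proof.
case/andP; case: i => [|[|[|//]]]; case: i' => [|[|[|//]]] // _ _;
case: j => [|[|[|//]]]; case: j' => [|[|[|//]]] // _ _ _;
  rewrite /branchA /subdiv /nth !in_cons ?mem_rev ?mem_iota ?in_nil; lia.
Qed.

Lemma pages_ge3 k : embeds_in_pages E k -> 3 <= k.
Proof.
have [idx [idx_inj idx_lt idx_surj idxE]] := index_exists.
case/key_of_embeds_in_pages => pos [col [pos_inj colC col_lt col_ok]].
rewrite leqNgt; apply/negP => k_lt3.
(* The remainder makes [vtx] total on the naturals. *)
have pre_ex m : exists x : E, idx x == m %% (6 * h).
  have lt_m : m %% (6 * h) < 6 * h by rewrite ltn_mod; lia.
  by have [x /eqP] := idx_surj _ lt_m; exists x.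
pose vtx m := xchoose (pre_ex m).
have vtxK m : m < 6 * h -> idx (vtx m) = m.
  by move=> lt_m; rewrite (eqP (xchooseP (pre_ex m))) modn_small.
(* With colours below 2, being 0 tells the pages apart. *)
apply: (@no_K33 E pos (fun x y => col x y == 0) pos_inj _ _
  (vtx \o branchA) (vtx \o branchB) (fun i j => map vtx (subdiv i j))).
- by move=> x y; rewrite colC.
- move=> x y z t xy zt xz zy yt; have := col_ok _ _ _ _ xy zt xz zy yt.
  by have := col_lt _ _ xy; have := col_lt _ _ zt; lia.
- move=> i j lt_i lt_j; rewrite [(_ \o _) i]/= path_map.
  apply: (sub_in_path (P := [pred m | m < 6 * h])) (subdiv_path lt_i lt_j).
    move=> m n m_lt n_lt mn; have := idxE (vtx m) (vtx n); rewrite !vtxK // => adjE.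
    by rewrite -adjE in mn.
  by apply/allP => m; apply: subdiv_lt.
- by move=> i j lt_i lt_j; rewrite [(_ \o _) i]/= last_map subdiv_last.
move=> i j i' j' lt_ii' lt_j lt_j' neq_j; have /andP[ltii' lt_i'] := lt_ii'.
have lt_i := ltn_trans ltii' lt_i'.
rewrite ![(_ \o _) _]/= -!map_cons; apply/hasPn => _ /mapP[n n_in ->]; apply/negP => /mapP[m m_in].
move/(congr1 idx); rewrite !vtxK ?(subdiv_lt lt_i lt_j m_in) ?(subdiv_lt lt_i' lt_j' n_in) //.
by move=> eq_nm; rewrite eq_nm in n_in; apply: (subdiv_disjoint lt_ii' lt_j lt_j' neq_j m_in n_in).
Qed.

End MobiusPages.

Theorem theorem3p5 (h : nat) (h_ge3 : 3 <= h) :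
  pagenumber (complete_expansion (mobius_ladder h)) = 3.
Proof.
rewrite /pagenumber; case: ex_minnP => k embk min_k.
by apply/eqP; rewrite eqn_leq (min_k _ (embeds_in_3_pages h_ge3)) (pages_ge3 h_ge3 embk).
Qed.
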